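(* For every integer $r\ge 2$, $$\tau_{\ge}(r)=\min\bigl\{n:\ \exists\,\lambda\vdash n\ \text{ with } s(\lambda)\ge r\ \text{ or }\ t(\lambda)\ge r\bigr\}.$$ Equivalently, $\tau_{\ge}(r)$ is the first value of $n$ for which there exists a partition of $n$ admitting at least $r$ admissible transfers with a common removable corner or at least $r$ admissible transfers with a common addable corner.
   Context: For $n\ge 1$, the partition graph $G_n$ is the simple graph whose vertices are the integer partitions of $n$; two distinct partitions are adjacent if one is obtained from the other by an elementary transfer of one unit from one part to another, followed by reordering. The receiving part may be a part equal to $0$ (i.e. the unit may form a new part of size $1$), and a part reduced to $0$ is deleted. $K_n=\mathrm{Cl}(G_n)$ is the clique complex of $G_n$: its simplices are the nonempty cliques of $G_n$, and a clique with $d+1$ vertices is a simplex of dimension $d$. For a vertex $\lambda$ of $G_n$, the local simplex dimension $\dim_{\mathrm{loc}}(\lambda)$ is the maximum of $\dim\sigma$ over all simplices $\sigma$ of $K_n$ containing $\lambda$; equivalently, $\dim_{\mathrm{loc}}(\lambda)=d$ iff the largest clique of $G_n$ containing $\lambda$ has cardinality $d+1$. For $r\ge 0$: $L_{\ge r}(n)=\{\lambda\in V(G_n):\dim_{\mathrm{loc}}(\lambda)\ge r\}$, and $\tau_{\ge}(r)=\min\{n\ge 1:L_{\ge r}(n)\neq\varnothing\}$, whenever this set of $n$ is nonempty. Identify a partition with its Ferrers diagram. $\mathrm{Rem}(\lambda)$ is the set of removable corners of $\lambda$ (cells of the diagram whose removal leaves the diagram of a partition) and $\mathrm{Add}(\lambda)$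 is the set of addable corners (cells not in the diagram whose addition gives the diagram of a partition). For $c\in\mathrm{Rem}(\lambda)$ and $a\in\mathrm{Add}(\lambda)$, $\lambda(c\to a)$ is the diagram obtained by removing the cell $c$ and adding the cell $a$; the transfer is admissible if the resulting diagram is again the diagram of a partition and is different from $\lambda$. Star and top capacities: if $n=1$, set $s((1))=t((1))=0$. If $n\ge 2$, put $A_{\max}(\lambda,c)=\{a\in\mathrm{Add}(\lambda):\lambda(c\to a)\text{ is admissible}\}$ for $c\in\mathrm{Rem}(\lambda)$, and $C_{\max}(\lambda,a)=\{c\in\mathrm{Rem}(\lambda):\lambda(c\to a)\text{ is admissible}\}$ for $a\in\mathrm{Add}(\lambda)$; then $$s(\lambda)=\max_{c\in\mathrm{Rem}(\lambda)}|A_{\max}(\lambda,c)|,\qquad t(\lambda)=\max_{a\in\mathrm{Add}(\lambda)}|C_{\max}(\lambda,a)|.$$ *)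

(* Defs.v *)
From HB Require Import structures.
From mathcomp Require Import all_boot.

Set Implicit Arguments.
Unset Strict Implicit.
Unset Printing Implicit Defensive.

Definition is_partition_of (n : nat) (l : seq nat) : bool :=
  [&& sorted geq l, 0 \notin l & sumn l == n].

Record intpart (n : nat) : Type := IntPart {
  parts :> seq nat;
  partsP : is_partition_of n parts
}.

HB.instance Definition _ (n : nat) := [isSub for @parts n].
HB.instance Definition _ (n : nat) := [Countable of intpart n by <:].

Lemma filter_pad (s : seq nat) (k : nat) :
  all (ltn 0) s -> size s <= k -> [seq x <- mkseq (nth 0 s) k | 0 < x] = s.
Proof.
move=> /all_filterP s_gt0 /subnKC <-.
rewrite /mkseq iotaD map_cat filter_cat add0n -/(mkseq _ _) mkseq_nth s_gt0.
rewrite -[RHS]cats0; congr (_ ++ _); apply/eqP.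
rewrite -(negbK (_ == _)) -has_filter; apply/hasPn => x /mapP[i].
by rewrite mem_iota => /andP[li _] ->; rewrite nth_default.
Qed.

Section IntPartFinite.
Variable n : nat.
Implicit Types l : intpart n.

Lemma intpart_gt0 l x : x \in parts l -> 0 < x.
Proof.
by case/and3P: (partsP l) => _ l0 _ xl; rewrite lt0n; apply: contraNneq l0 => <-.
Qed.

Lemma sumn_intpart l : sumn l = n.
Proof. by case/and3P: (partsP l) => _ _ /eqP. Qed.

Lemma leq_intpart l x : x \in parts l -> x <= n.
Proof.
rewrite -[leqRHS](sumn_intpart l); elim: (parts l) => //= y s IHs.
rewrite inE => /predU1P[->|/IHs le_x]; first exact: leq_addr.
exact: leq_trans le_x (leq_addl _ _).
Qed.

Lemma size_intpart l : size l <= n.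
Proof.
rewrite -[leqRHS](sumn_intpart l); have := @intpart_gt0 l.
elim: (parts l) => //= y s IHs pos.
rewrite -add1n leq_add ?pos ?mem_head //.
by apply: IHs => x xs; apply: pos; rewrite inE xs orbT.
Qed.

Definition intpart_code l : n.-tuple 'I_n.+1 := [tuple inord (nth 0 l i) | i < n].
Definition intpart_decode (t : n.-tuple 'I_n.+1) : option (intpart n) :=
  insub [seq x <- map val t | 0 < x].

Lemma intpart_codeK : pcancel intpart_code intpart_decode.
Proof.
move=> l; rewrite /intpart_decode.
suff ->: [seq x <- map val (intpart_code l) | 0 < x] = val l by rewrite valK.
have -> : map val (intpart_code l) = mkseq (nth 0 l) n.
  rewrite /= -map_comp /mkseq -val_enum_ord -map_comp; apply: eq_map => i /=.
  rewrite inordK // ltnS; case: (ltnP i (size l)) => il.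
    exact/leq_intpart/mem_nth.
  by rewrite nth_default.
by apply: filter_pad (size_intpart l); apply/allP => x /intpart_gt0.
Qed.

HB.instance Definition _ := isFinite.Build (intpart n)
  (pcan_enumP intpart_codeK).

End IntPartFinite.

(* One unit moves from the part of index i to the part of index j; the index
   j = size l stands for a part equal to 0 (incr_nth then appends a 1). *)
Definition transfer (l : seq nat) (i j : nat) : seq nat :=
  sort geq [seq x <- incr_nth (set_nth 0 l i (nth 0 l i).-1) j | 0 < x].

Definition elem_transfer (l m : seq nat) : bool :=
  [exists i : 'I_(size l), exists j : 'I_(size l).+1,
     (i != j :> nat) && (m == transfer l i j)].

Definition adjacent (n : nat) (x y : intpart n) : bool :=
  (x != y) && (elem_transfer x y || elem_transfer y x).

Definition is_clique (n : nat) (S : {set intpart n}) : bool :=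
  [forall x in S, forall y in S, (x != y) ==> adjacent x y].

Definition clique_complex (n : nat) : {set {set intpart n}} :=
  [set S : {set intpart n} | (S != set0) && is_clique S].

Definition dim_simplex (n : nat) (S : {set intpart n}) : nat := #|S|.-1.

Definition dim_loc (n : nat) (x : intpart n) : nat :=
  \max_(S in clique_complex n | x \in S) dim_simplex S.

Definition L_ge (r n : nat) : {set intpart n} :=
  [set x : intpart n | r <= dim_loc x].

Definition is_min (P : nat -> Prop) (m : nat) : Prop :=
  P m /\ forall k, P k -> m <= k.

Definition is_tau_ge (r m : nat) : Prop :=
  is_min (fun n => 1 <= n /\ L_ge r n != set0) m.

(* Cells (row, column), counted from 0. The (n+1) x (n+1) box contains the
   diagrams of all partitions of n together with all their addable corners. *)
Notation cell n := ('I_n.+1 * 'I_n.+1)%type.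

Definition in_ferrers (l : seq nat) (i j : nat) : bool := j < nth 0 l i.

Definition ferrers (n : nat) (l : seq nat) : {set cell n} :=
  [set c : cell n | in_ferrers l c.1 c.2].

(* A partition with diagram D is a partition of #|D|; in particular the
   equality below excludes partitions whose diagram leaves the box. *)
Definition is_diagram (n : nat) (D : {set cell n}) : bool :=
  [exists m : intpart #|D|, D == ferrers n m].

Definition Rem (n : nat) (x : intpart n) : {set cell n} :=
  [set c in ferrers n x | is_diagram (ferrers n x :\ c)].

Definition Add (n : nat) (x : intpart n) : {set cell n} :=
  [set a in ~: ferrers n x | is_diagram (a |: ferrers n x)].

Definition move_cell (n : nat) (x : intpart n) (c a : cell n) : {set cell n} :=
  a |: (ferrers n x :\ c).

Definition admissible (n : nat) (x : intpart n) (c a : cell n) : bool :=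
  is_diagram (move_cell x c a) && (move_cell x c a != ferrers n x).

Definition A_max (n : nat) (x : intpart n) (c : cell n) : {set cell n} :=
  [set a in Add x | admissible x c a].

Definition C_max (n : nat) (x : intpart n) (a : cell n) : {set cell n} :=
  [set c in Rem x | admissible x c a].

Definition star_capacity (n : nat) (x : intpart n) : nat :=
  if n == 1 then 0 else \max_(c in Rem x) #|A_max x c|.

Definition top_capacity (n : nat) (x : intpart n) : nat :=
  if n == 1 then 0 else \max_(a in Add x) #|C_max x a|.

(* Main.v *)
Require Import Defs.
From HB Require Import structures.
From mathcomp Require Import all_boot.

(** For every partition x and every r > 0, x lies in a clique of r + 1 vertices if
    and only if r admissible transfers from x have a common removed cell or a
    common added cell ([leq_dim_loc_transfers]). So the three sets of integers n
    whose minima are compared coincide, and it only remains to see that they are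
    not empty.

    The pointwise equivalence comes from geometry of sets. Read as a set of cells,
    a partition of n is a down-closed set with n elements, and every such set
    arises once ([ferrers_inj], [card_ferrers], [down_closed_ferrers]). An
    elementary transfer, whatever reordering follows it, replaces one cell by
    another, and conversely; hence two partitions are adjacent exactly when their
    diagrams differ by one cell ([adjacentE]). The partition graph is thus an
    induced subgraph of a Johnson graph, whose cliques are of two kinds: all
    members contain a common set with n - 1 elements, or all are contained in a
    common set with n + 1 elements ([clique_star_or_top]). In a clique through x,
    the common set is the diagram of x without a cell c, respectively with an
    extra cell a, and c and a are corners because down-closed sets are stable
    under intersection and union ([card_ferrersD_move]). Conversely all partitions
    containing, respectively contained in, such a set form a clique, whose members
    other than x are the results of the transfers with that common corner
    ([card_A_max], [card_C_max]).

    For existence, the r + 1 ways to add a cell to the staircase (r, ..., 2, 1)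
    give a clique with r + 1 vertices ([stair_dim_loc]). *)

Set Implicit Arguments.
Unset Strict Implicit.
Unset Printing Implicit Defensive.

(** * Finite sets *)

Lemma card_ord_lt N k : k <= N -> #|[set j : 'I_N | j < k]| = k.
Proof.
move=> le_kN; rewrite -sum1dep_card -(big_ord_widen _ (fun=> 1) le_kN).
by rewrite sum1_card card_ord.
Qed.

Lemma leq_bigmax_exists (I : finType) (P : pred I) (F : I -> nat) r : 0 < r ->
  r <= \max_(i | P i) F i <-> exists2 i, P i & r <= F i.
Proof.
move=> r_gt0; split=> [|[i Pi /leq_trans->] //]; last exact: leq_bigmax_cond.
have [/exists_inP // | no_i] := boolP [exists (i | P i), r <= F i].
rewrite leqNgt; case/negP; rewrite -(prednK r_gt0) ltnS; apply/bigmax_leqP => i Pi.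
rewrite -ltnS (prednK r_gt0) ltnNge; apply: contra no_i => le_r.
by apply/exists_inP; exists i.
Qed.

(** Exchanging (c, a) and (d, b) with c <> d and a <> b gives two sets
    such that the first contains a and d, which the second lacks. *)
Lemma exchange_common (T : finType) (X : {set T}) c a d b :
    c \in X -> a \notin X -> d \in X -> b \notin X ->
    #|(a |: X :\ c) :\: (b |: X :\ d)| <= 1 ->
  c = d \/ a = b.
Proof.
move=> Xc notXa Xd notXb /card_le1_eqP le1.
have [->|ne_cd] := eqVneq c d; first by left.
have [->|ne_ab] := eqVneq a b; first by right.
have ne_db : d != b by apply: contraNneq notXb => <-.
suff eq_ad : a = d by rewrite eq_ad Xd in notXa.
apply: le1; rewrite in_setD !in_setU1 !in_setD1 ?eqxx.
  by rewrite (negPf ne_db) [d == c]eq_sym ne_cd Xd orbT.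
by rewrite (negPf ne_ab) (negPf notXa) andbF.
Qed.

(** * Nonincreasing sequences *)

Lemma geq_trans : transitive geq.
Proof. by move=> y x z le_yx le_zy; apply: leq_trans le_zy le_yx. Qed.

(** A diagram read by columns: a nonincreasing sequence is recovered from the
    number of its entries above each level. Since that number is insensitive to
    reordering and to zero entries, it makes the sorting and the deletions in an
    elementary transfer invisible. *)
Lemma ltn_nth_count (s : seq nat) i j :
  sorted geq s -> (j < nth 0 s i) = (i < count (ltn j) s).
Proof.
elim: s i => [|x s IHs] i /=; first by rewrite nth_nil.
rewrite (path_sortedE geq_trans) => /andP[/allP le_s_x s_sorted].
have [lt_jx | le_xj] /= := ltnP j x; first by case: i => [|i] //=; rewrite IHs.
have count0 : count (ltn j) s = 0.
  apply/eqP; rewrite -leqn0 leqNgt -has_count; apply/hasPn => y /le_s_x le_yx.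
  by rewrite /= -leqNgt (leq_trans le_yx).
by case: i => [|i] /=; rewrite ?IHs // count0 // ltnNge le_xj.
Qed.

Lemma nth_geq_antitone (s : seq nat) i j :
  sorted geq s -> i <= j -> nth 0 s j <= nth 0 s i.
Proof.
move=> s_sorted le_ij; rewrite leqNgt (ltn_nth_count _ _ s_sorted) -leqNgt.
by apply: leq_trans le_ij; rewrite leqNgt -(ltn_nth_count _ _ s_sorted) ltnn.
Qed.

Lemma count_gt_pos (s : seq nat) j :
  count (ltn j) [seq x <- s | 0 < x] = count (ltn j) s.
Proof.
by rewrite count_filter; apply: eq_count => -[|x] //=; rewrite andbT.
Qed.

Lemma count_gt_incr_nth (s : seq nat) i j :
  count (ltn j) s <= count (ltn j) (incr_nth s i).
Proof.
elim: s i => [|x s IHs] [|i] //=; last by rewrite leq_add2l.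
by rewrite leq_add2r; case: (ltnP j x) => // lt_jx; rewrite (ltnW lt_jx : j < x.+1).
Qed.

Lemma sumn_incr_nth (s : seq nat) i : sumn (incr_nth s i) = (sumn s).+1.
Proof.
elim: s i => [|x s IHs] [|i] //=; last by rewrite IHs addnS.
by elim: i.
Qed.

Section Partitions.
Variable n : nat.
Implicit Types (x y z : intpart n) (D : {set cell n}) (c a : cell n).

Lemma intpart_sorted x : sorted geq x.
Proof. by case/and3P: (partsP x). Qed.

Lemma intpart_pos x : all (ltn 0) x.
Proof. by apply/allP => p; apply: intpart_gt0. Qed.

Lemma nth_intpart_leq x i : nth 0 x i <= n.
Proof.
by have [lt_i|?] := ltnP i (size x); [apply/leq_intpart/mem_nth | rewrite nth_default].
Qed.

Lemma intpart_nth_inj x y :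
  (forall i, i <= n -> nth 0 x i = nth 0 y i) -> x = y.
Proof.
move=> eq_xy; apply: val_inj.
rewrite /= -(filter_pad (intpart_pos x) (size_intpart x)).
rewrite -(filter_pad (intpart_pos y) (size_intpart y)).
congr filter; apply/eq_in_map => i; rewrite mem_iota => /ltnW; exact: eq_xy.
Qed.

(** * Diagrams as down-closed sets of cells *)

(** Down-closedness makes no reference to a list of parts, which turns all later
    questions about diagrams into questions about sets. *)
Definition down_closed D := forall c d : cell n,
  d \in D -> c.1 <= d.1 -> c.2 <= d.2 -> c \in D.

Lemma down_closedI D D' :
  down_closed D -> down_closed D' -> down_closed (D :&: D').
Proof.
move=> clD clD' c d /setIP[dD dD'] le1 le2.
by rewrite inE (clD c d) // (clD' c d).
Qed.

Lemma down_closedU D D' :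
  down_closed D -> down_closed D' -> down_closed (D :|: D').
Proof.
by move=> clD clD' c d /setUP[] dD le1 le2; rewrite inE;
  [rewrite (clD c d) | rewrite (clD' c d) // orbT].
Qed.

Definition row_length D (i : 'I_n.+1) : nat := #|[set j | (i, j) \in D]|.

Lemma card_row_length D : #|D| = \sum_i row_length D i.
Proof.
under eq_bigr do rewrite /row_length -sum1dep_card.
rewrite pair_big_dep /= -sum1_card.
by apply: eq_bigl => -[].
Qed.

(** In a down-closed set each row is an initial segment, determined by its
    length. *)
Lemma ltn_row_length D i (j : 'I_n.+1) :
  down_closed D -> (j < row_length D i) = ((i, j) \in D).
Proof.
move=> clD; apply/idP/idP => [|Dij]; last first.
  rewrite -(card_ord_lt (ltn_ord j)); apply/subset_leq_card/subsetP => k.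
  by rewrite !inE ltnS => le_kj; apply: clD Dij _ _.
apply: contraLR => notDij; rewrite -leqNgt.
rewrite -(card_ord_lt (ltnW (ltn_ord j))); apply/subset_leq_card/subsetP => k.
rewrite !inE ltnNge; apply: contraL => le_jk.
by apply: contra notDij => Dik; apply: clD Dik _ _.
Qed.

Lemma mem_ferrers x c : (c \in ferrers n x) = (c.2 < nth 0 x c.1).
Proof. by rewrite inE. Qed.

Lemma ferrers_down_closed (s : seq nat) :
  sorted geq s -> down_closed (ferrers n s).
Proof.
move=> s_sorted c d; rewrite !inE /in_ferrers => d_in le1 le2.
by apply: leq_ltn_trans le2 (leq_trans d_in _); apply: nth_geq_antitone.
Qed.

Lemma row_length_ferrers x i : row_length (ferrers n x) i = nth 0 x i.
Proof.
rewrite -[RHS](@card_ord_lt n.+1); last exact: leqW (nth_intpart_leq _ _).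
by apply: eq_card => j; rewrite !inE.
Qed.

Lemma ferrers_inj : injective (fun x => ferrers n x).
Proof.
move=> x y /= eq_xy; apply: intpart_nth_inj => i le_in.
have := row_length_ferrers x (Ordinal (le_in : i < n.+1)).
by rewrite eq_xy row_length_ferrers.
Qed.

Lemma card_ferrers x : #|ferrers n x| = n.
Proof.
rewrite card_row_length; under eq_bigr do rewrite row_length_ferrers.
rewrite -[RHS](sumn_intpart x) sumnE (big_nth 0) big_mkord.
rewrite (big_ord_widen n.+1 (nth 0 x)); last exact: leqW (size_intpart x).
rewrite [RHS]big_mkcond; apply: eq_bigr => i _.
by case: ltnP => // ?; rewrite nth_default.
Qed.

Definition row_lengths D : seq nat := mkseq (fun i => row_length D (inord i)) n.+1.

Lemma row_lengths_sorted D : down_closed D -> sorted geq (row_lengths D).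
Proof.
move=> clD; apply/(sortedP 0) => i; rewrite size_mkseq => lt_i.
rewrite !nth_mkseq ?(ltnW lt_i) //.
apply/subset_leq_card/subsetP => j; rewrite !inE => Dij.
by apply: clD Dij _ _; rewrite //= !inordK // ltnW.
Qed.

Lemma row_lengths_partition D :
  down_closed D -> is_partition_of #|D| [seq p <- row_lengths D | 0 < p].
Proof.
move=> clD; apply/and3P; split.
- by apply: (sorted_filter geq_trans); apply: row_lengths_sorted.
- by rewrite mem_filter.
rewrite card_row_length sumnE big_filter big_map -/(index_iota 0 n.+1).
rewrite big_mkord big_mkcond; apply/eqP/eq_bigr => i _.
by rewrite inord_val; case: (row_length D i).
Qed.

Lemma ferrers_row_lengths D :
  down_closed D -> ferrers n [seq p <- row_lengths D | 0 < p] = D.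
Proof.
move=> clD; apply/setP => -[i j]; rewrite inE /in_ferrers /=.
have /and3P[parts_sorted _ _] := row_lengths_partition clD.
rewrite -[RHS]ltn_row_length // (ltn_nth_count _ _ parts_sorted) count_gt_pos.
rewrite -(ltn_nth_count _ _ (row_lengths_sorted clD)).
by rewrite nth_mkseq // inord_val.
Qed.

Lemma is_diagramP D : reflect (down_closed D) (is_diagram D).
Proof.
apply: (iffP existsP) => [[m /eqP->] | clD].
  by apply: ferrers_down_closed; case/and3P: (partsP m).
by exists (IntPart (row_lengths_partition clD)); rewrite /= ferrers_row_lengths.
Qed.

(** Together with [ferrers_inj] and [card_ferrers], this identifies the
    partitions of n with the down-closed sets of n cells. *)
Lemma down_closed_ferrers D :
  down_closed D -> #|D| = n -> exists x, ferrers n x = D.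
Proof.
move=> clD cardD; have := row_lengths_partition clD; rewrite {1}cardD => partD.
by exists (IntPart partD); rewrite /= ferrers_row_lengths.
Qed.

Lemma ferrers_intpart_down_closed x : down_closed (ferrers n x).
Proof. exact/ferrers_down_closed/intpart_sorted. Qed.

(** * Adjacency *)

Lemma card_ferrersD x y :
  #|ferrers n x :\: ferrers n y| = #|ferrers n y :\: ferrers n x|.
Proof. by rewrite !cardsD setIC !card_ferrers. Qed.

Lemma ferrersD_gt0 x y : x != y -> 0 < #|ferrers n x :\: ferrers n y|.
Proof.
apply: contraNT; rewrite -leqNgt leqn0 cards_eq0 setD_eq0 => sub_xy.
by apply/eqP/ferrers_inj/eqP; rewrite eqEcard sub_xy !card_ferrers leqnn.
Qed.

(** Taking a unit from a part p lowers only the column p - 1 (counted from 0), by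
    one cell; the receiving part can only raise columns. *)
Lemma elem_transfer_card_le1 x y :
  elem_transfer x y -> #|ferrers n x :\: ferrers n y| <= 1.
Proof.
case/existsP=> i /existsP[j /andP[_ /eqP def_y]].
set p := nth 0 x i.
have col_le k : count (ltn k) x <= count (ltn k) y + (k == p.-1).
  rewrite def_y /transfer count_sort count_gt_pos.
  have := count_gt_incr_nth (set_nth 0 x i p.-1) j k.
  rewrite count_set_nth_ltn // -/p leq_subLR => le_col.
  rewrite -(leq_add2r (k < p.-1)) (leq_trans le_col) //.
  rewrite [leqLHS]addnC -addnA leq_add2l; case: (p) => //= q.
  by rewrite ltnS (leq_eqVlt k); case: eqP; case: ltnP.
have mem_col z d : (d \in ferrers n z) = (d.1 < count (ltn d.2) z).
  by rewrite inE -ltn_nth_count //; apply: intpart_sorted.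
(* Only the lowest cell of the column p - 1 can be lost. *)
suff colE d : d \in ferrers n x :\: ferrers n y ->
    d = (inord (count (ltn p.-1) x).-1, inord p.-1).
  by apply/card_le1_eqP => d d' /colE-> /colE->.
rewrite in_setD !mem_col -leqNgt => /andP[ge_y lt_x].
have d2E : d.2 = p.-1 :> nat.
  apply/eqP; move: (col_le d.2); case: eqP => //= _; rewrite addn0.
  by move=> /(leq_trans lt_x); rewrite ltnNge ge_y.
have d1E : d.1 = (count (ltn p.-1) x).-1 :> nat.
  rewrite -d2E; apply/eqP; rewrite eqn_leq -ltnS (ltn_predK lt_x) lt_x /=.
  rewrite -ltnS (ltn_predK lt_x); move: (col_le d.2); rewrite d2E eqxx addn1.
  by move=> /leq_trans-> //; rewrite ltnS -d2E.
by rewrite -d1E -d2E !inord_val; case: (d).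
Qed.

Lemma row_lengthU1 D a i :
  a \notin D -> row_length (a |: D) i = (i == a.1) + row_length D i.
Proof.
case: a => k l /= notDa; have [->{i} | /eqP ne_ik] := eqP.
  have -> : row_length ((k, l) |: D) k = #|l |: [set j | (k, j) \in D]|.
    by apply: eq_card => j; rewrite !inE xpair_eqE eqxx.
  by rewrite cardsU1 inE notDa.
by apply: eq_card => j; rewrite !inE xpair_eqE (negPf ne_ik).
Qed.

(** A sequence that agrees with a partition up to trailing zeros is normalised
    to that partition. *)
Lemma sort_filter_intpart y (s : seq nat) :
  nth 0 s =1 nth 0 y -> sort geq [seq p <- s | 0 < p] = y.
Proof.
move=> eq_sy; have le_size : size y <= size s.
  rewrite leqNgt; apply/negP => lt_size.
  have := allP (intpart_pos y) _ (mem_nth 0 lt_size).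
  by rewrite -eq_sy nth_default.
have <- : mkseq (nth 0 y) (size s) = s.
  by rewrite -{2}(mkseq_nth 0 s); apply: eq_mkseq => k; rewrite eq_sy.
rewrite (filter_pad (intpart_pos y) le_size).
exact: sorted_sort geq_trans _ (intpart_sorted y).
Qed.

(** The cells c and a lie in different rows, and a is at most one row below x, so
    that their rows are legitimate indices for a transfer; the rows of y are then
    those of x after this transfer, without any reordering. *)
Lemma move_cell_elem_transfer x y c a :
    c \in ferrers n x -> a \notin ferrers n x -> ferrers n y = move_cell x c a ->
  elem_transfer x y.
Proof.
move=> xc notxa def_y.
have ne_ca : c != a by apply: contraNneq notxa => <-.
have ya : a \in ferrers n y by rewrite def_y !inE eqxx.
have notyc : c \notin ferrers n y by rewrite def_y !inE (negPf ne_ca) eqxx.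
have ne_row : c.1 != a.1.
  apply/eqP=> eq_row; move: xc notxa ya notyc; rewrite !mem_ferrers eq_row -!leqNgt.
  move=> lt_cx le_xa lt_ay le_yc; have := leq_trans lt_cx le_xa.
  by rewrite ltnNge (leq_trans (ltnW lt_ay) le_yc).
have lt_c : c.1 < size x.
  rewrite ltnNge; apply/negP => le_xc.
  by move: xc; rewrite mem_ferrers nth_default.
have le_a : a.1 < (size x).+1.
  rewrite ltnS leqNgt; apply/negP => lt_xa.
  have lt_size : size x < n.+1 := size_intpart x.
  have := ferrers_intpart_down_closed (c := (Ordinal lt_size, a.2)) ya.
  rewrite def_y !inE /in_ferrers /= nth_default // ltn0 andbF orbF.
  move=> /(_ (ltnW lt_xa) (leqnn _)) /eqP eq_a.
  by move: lt_xa; rewrite -eq_a ltnn.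
apply/existsP; exists (Ordinal lt_c); apply/existsP; exists (Ordinal le_a).
rewrite /= -val_eqE /= in ne_row *; rewrite ne_row /= eq_sym.
apply/eqP/sort_filter_intpart => k; rewrite nth_incr_nth nth_set_nth /=.
have [le_kn | lt_nk] := leqP k n; last first.
  have ne_k (i : 'I_n.+1) : k == i = false.
    by apply/negP => /eqP eq_k; move: (ltn_ord i); rewrite -eq_k ltnS leqNgt lt_nk.
  have le_size z : size z <= k := leq_trans (size_intpart z) (ltnW lt_nk).
  by rewrite eq_sym !ne_k !nth_default.
have := row_length_ferrers y (Ordinal (le_kn : k < n.+1)).
have := row_length_ferrers x (Ordinal (le_kn : k < n.+1)).
rewrite def_y -{1}(setD1K xc) !row_lengthU1 ?setD11 //; last first.
  by rewrite !inE negb_and; case/negPf: notxa; rewrite inE => ->; rewrite orbT.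
rewrite -!val_eqE /= => row_x row_y; rewrite -row_y [in LHS]eq_sym.
case: (k =P c.1) => [eq_kc | /eqP/negPf ne_kc]; last by rewrite -row_x ne_kc.
have <- : nth 0 x k = nth 0 x c.1 by rewrite eq_kc.
by rewrite -row_x (introT eqP eq_kc).
Qed.

Lemma move_cell_ferrers x c a :
    c \in ferrers n x -> a \notin ferrers n x -> admissible x c a ->
  exists2 y, y != x & ferrers n y = move_cell x c a.
Proof.
move=> xc notxa /andP[/is_diagramP cl_move ne_move].
have card_move : #|move_cell x c a| = n.
  rewrite cardsU1 in_setD1 (negPf notxa) andbF.
  by rewrite -[RHS](card_ferrers x) (cardsD1 c (ferrers n x)) xc.
have [y def_y] := down_closed_ferrers cl_move card_move; exists y => //.
by apply: contraNneq ne_move => eq_yx; rewrite -def_y eq_yx.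
Qed.

(** The intersection and the union of two diagrams are diagrams, so the cells
    exchanged by adjacent partitions are corners. *)
Lemma card_ferrersD_move x y :
    #|ferrers n x :\: ferrers n y| = 1 ->
  exists c a, [/\ c \in Rem x, a \in Add x, admissible x c a
                & ferrers n y = move_cell x c a].
Proof.
move=> diff1; have /cards1P[c defc] := introT eqP diff1.
have /cards1P[a defa] : #|ferrers n y :\: ferrers n x| == 1.
  by rewrite card_ferrersD diff1.
have /andP[notyc xc] : (c \notin ferrers n y) && (c \in ferrers n x).
  by rewrite -in_setD defc set11.
have /andP[notxa ya] : (a \notin ferrers n x) && (a \in ferrers n y).
  by rewrite -in_setD defa set11.
have cl_x := @ferrers_intpart_down_closed x.
have cl_y := @ferrers_intpart_down_closed y.
have defI : ferrers n x :\ c = ferrers n x :&: ferrers n y.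
  by rewrite -defc setDDr setDv set0U.
have def_y : ferrers n y = move_cell x c a.
  by rewrite /move_cell defI -defa setIC setUC setID.
have defU : a |: ferrers n x = ferrers n x :|: ferrers n y.
  by rewrite -defa setUC setDE setUIr setUCr setIT.
exists c, a; split=> //.
- by rewrite inE xc defI; apply/is_diagramP/down_closedI.
- by rewrite inE in_setC notxa defU; apply/is_diagramP/down_closedU.
rewrite /admissible -def_y; apply/andP; split; first exact/is_diagramP.
by apply: contraTneq ya => ->.
Qed.

(** The graph of partitions is an induced subgraph of the Johnson graph on the
    n-sets of cells: reordering and zero parts have disappeared. *)
Lemma adjacentE x y : adjacent x y = (#|ferrers n x :\: ferrers n y| == 1).
Proof.
apply/andP/eqP => [[ne_xy tr_xy] | diff1].
  apply/eqP; rewrite eqn_leq ferrersD_gt0 // andbT.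
  by case/orP: tr_xy => /elem_transfer_card_le1 //; rewrite card_ferrersD.
split; first by apply: contra_eqN diff1 => /eqP->; rewrite setDv cards0.
have [c [a [xc xa _ def_y]]] := card_ferrersD_move diff1.
apply/orP; left; apply: move_cell_elem_transfer def_y.
  by case/setIdP: xc.
by case/setIdP: xa; rewrite in_setC.
Qed.

Lemma is_cliqueP (S : {set intpart n}) :
  reflect {in S &, forall y z, y != z -> #|ferrers n y :\: ferrers n z| = 1}
          (is_clique S).
Proof.
apply: (iffP forall_inP) => [clS y z Sy Sz ne_yz | clS y Sy].
  by have /forall_inP/(_ z Sz) := clS y Sy; rewrite ne_yz adjacentE => /eqP.
by apply/forall_inP => z Sz; apply/implyP => /clS; rewrite adjacentE => ->.
Qed.

(** * Stars and tops *)

Definition star x c : {set intpart n} :=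
  [set y : intpart n | ferrers n x :\ c \subset ferrers n y].

Definition top x a : {set intpart n} :=
  [set y : intpart n | ferrers n y \subset a |: ferrers n x].

Lemma star_clique x c : c \in ferrers n x -> is_clique (star x c).
Proof.
move=> xc; apply/is_cliqueP => y z; rewrite !inE => sub_y sub_z ne_yz.
apply/eqP; rewrite eqn_leq ferrersD_gt0 // andbT.
apply: leq_trans (subset_leq_card (setDS _ sub_z)) _.
rewrite cardsD (setIidPr sub_y) card_ferrers -{1}(card_ferrers x).
by rewrite (cardsD1 c (ferrers n x)) xc addnK.
Qed.

Lemma top_clique x a : a \notin ferrers n x -> is_clique (top x a).
Proof.
move=> notxa; apply/is_cliqueP => y z; rewrite !inE => sub_y sub_z ne_yz.
apply/eqP; rewrite eqn_leq ferrersD_gt0 // andbT.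
apply: leq_trans (subset_leq_card (setSD _ sub_y)) _.
by rewrite cardsD (setIidPr sub_z) card_ferrers cardsU1 notxa card_ferrers addnK.
Qed.

Lemma mem_star x c : x \in star x c.
Proof. by rewrite inE subsetDl. Qed.

Lemma mem_top x a : x \in top x a.
Proof. by rewrite inE subsetUr. Qed.

(** The transfers with removed cell c are the vertices other than x of the clique
    of all partitions containing the diagram of x without c. *)
Lemma card_A_max x c :
  c \in ferrers n x -> #|A_max x c| = #|star x c :\ x|.
Proof.
move=> xc; rewrite -(card_imset _ ferrers_inj).
rewrite -(@card_in_imset _ _ (move_cell x c)); last first.
  move=> a b /setIdP[/setIdP[notxa _] _] _; rewrite in_setC in notxa.
  move/setP/(_ a); rewrite !in_setU1 eqxx in_setD1 (negPf notxa) andbF !orbF.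
  by move/esym/eqP.
apply: eq_card => D; apply/imsetP/imsetP => [[a /setIdP[xa adm] ->] | [y]].
  have /setIdP[notxa _] := xa; rewrite in_setC in notxa.
  have [y ne_yx def_y] := move_cell_ferrers xc notxa adm.
  by exists y; rewrite ?in_setD1 ?ne_yx ?inE def_y ?subsetUr.
case/setD1P=> ne_yx star_y ->{D}.
have /is_cliqueP/(_ x y (mem_star _ _) star_y) := star_clique xc.
rewrite eq_sym => /(_ ne_yx)/card_ferrersD_move[d [a [xd xa adm def_y]]].
suff eq_dc : d = c by rewrite eq_dc in adm def_y; exists a => //; apply/setIdP.
case/setIdP: xd => xd _; case/setIdP: xa => notxa _; rewrite in_setC in notxa.
have ne_da : d != a by apply: contraNneq notxa => <-.
move: star_y; rewrite inE def_y => /subsetP/(_ d).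
rewrite in_setU1 !in_setD1 eqxx xd (negPf ne_da) !andbT /=.
by case: eqP => // _ /(_ isT).
Qed.

(** Dually, the transfers with added cell a are the vertices other than x of the
    clique of all partitions contained in the diagram of x with a. *)
Lemma card_C_max x a :
  a \notin ferrers n x -> #|C_max x a| = #|top x a :\ x|.
Proof.
move=> notxa; rewrite -(card_imset _ ferrers_inj).
rewrite -(@card_in_imset _ _ (move_cell x ^~ a)); last first.
  move=> c d /setIdP[/setIdP[xc _] _] _.
  have ne_ca : c != a by apply: contraNneq notxa => <-.
  move/setP/(_ c); rewrite !in_setU1 !in_setD1 eqxx xc (negPf ne_ca) !andbT /=.
  by move/esym/negbFE/eqP.
apply: eq_card => D; apply/imsetP/imsetP => [[c /setIdP[xc adm] ->] | [y]].
  have /setIdP[c_in _] := xc.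
  have [y ne_yx def_y] := move_cell_ferrers c_in notxa adm.
  by exists y; rewrite ?in_setD1 ?ne_yx ?inE def_y ?setUS ?subsetDl.
case/setD1P=> ne_yx top_y ->{D}.
have /is_cliqueP/(_ x y (mem_top _ _) top_y) := top_clique notxa.
rewrite eq_sym => /(_ ne_yx)/card_ferrersD_move[c [b [xc xb adm def_y]]].
suff eq_ba : b = a by rewrite eq_ba in adm def_y; exists c => //; apply/setIdP.
case/setIdP: xb => notxb _; rewrite in_setC in notxb.
move: top_y; rewrite inE def_y => /subsetP/(_ b (setU11 _ _)).
by rewrite in_setU1 (negPf notxb) orbF => /eqP.
Qed.

(** * The cliques of the partition graph *)

(** The classical description of the cliques of a Johnson graph. Fix y0 in S other
    than x. If y1 in S does not remove the same cell of x as y0, then it adds the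
    same one; if y2 in S does not add the same cell as y0, then it removes the
    same one; such y1 and y2 would differ from each other in both cells. *)
Lemma clique_star_or_top x (S : {set intpart n}) :
    is_clique S -> x \in S -> 1 < #|S| ->
  (exists2 c, c \in Rem x & S \subset star x c) \/
  (exists2 a, a \in Add x & S \subset top x a).
Proof.
move=> /is_cliqueP clS Sx S_gt1.
have move_S y : y \in S -> y != x -> exists c a,
    [/\ c \in Rem x, a \in Add x, admissible x c a & ferrers n y = move_cell x c a].
  by move=> Sy ne_yx; apply: card_ferrersD_move; apply: clS; rewrite // eq_sym.
have S_common y z c a d b : y \in S -> z \in S -> c \in Rem x -> a \in Add x ->
    d \in Rem x -> b \in Add x -> ferrers n y = move_cell x c a ->
    ferrers n z = move_cell x d b -> c = d \/ a = b.
  move=> Sy Sz /setIdP[xc _] /setIdP[xa _] /setIdP[xd _] /setIdP[xb _] def_y def_z.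
  rewrite !in_setC in xa xb; apply: (exchange_common xc xa xd xb).
  rewrite -/(move_cell x c a) -/(move_cell x d b) -def_y -def_z.
  by have [->|/clS->] := eqVneq y z; rewrite ?setDv ?cards0.
have /card_gt0P[y0 /setD1P[ne_y0x Sy0]] : 0 < #|S :\ x|.
  by move: S_gt1; rewrite (cardsD1 x) Sx.
have [c0 [a0 [xc0 xa0 _ def_y0]]] := move_S y0 Sy0 ne_y0x.
have [sub_star | /subsetPn[y1 Sy1 notstar]] := boolP (S \subset star x c0).
  by left; exists c0.
have [sub_top | /subsetPn[y2 Sy2 nottop]] := boolP (S \subset top x a0).
  by right; exists a0.
have ne_y1x : y1 != x by apply: contraNneq notstar => ->; apply: mem_star.
have ne_y2x : y2 != x by apply: contraNneq nottop => ->; apply: mem_top.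
have [c1 [a1 [xc1 xa1 _ def_y1]]] := move_S y1 Sy1 ne_y1x.
have [c2 [a2 [xc2 xa2 _ def_y2]]] := move_S y2 Sy2 ne_y2x.
have ne_c : c1 <> c0.
  by move=> eq_c; case/negP: notstar; rewrite inE def_y1 eq_c subsetUr.
have ne_a : a2 <> a0.
  by move=> eq_a; case/negP: nottop; rewrite inE def_y2 eq_a setUS ?subsetDl.
have [//|eq_a1] := S_common _ _ _ _ _ _ Sy1 Sy0 xc1 xa1 xc0 xa0 def_y1 def_y0.
have [eq_c2|//] := S_common _ _ _ _ _ _ Sy2 Sy0 xc2 xa2 xc0 xa0 def_y2 def_y0.
have [|] := S_common _ _ _ _ _ _ Sy1 Sy2 xc1 xa1 xc2 xa2 def_y1 def_y2.
  by rewrite eq_c2.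
by rewrite eq_a1 => /esym.
Qed.

(** * Capacities *)

Lemma leq_dim_loc x r : 0 < r ->
  r <= dim_loc x <-> exists2 S, is_clique S /\ x \in S & r < #|S|.
Proof.
move=> r_gt0; split=> [/(leq_bigmax_exists _ _ r_gt0)[S] | [S [clS Sx] lt_r]].
  rewrite inE => /andP[/andP[S_neq0 clS] Sx] le_r; exists S => //.
  by move: S_neq0 le_r; rewrite -card_gt0 /dim_simplex; case: #|S|.
apply/(leq_bigmax_exists _ _ r_gt0); exists S.
  by rewrite inE clS Sx !andbT; apply/set0Pn; exists x.
by rewrite /dim_simplex -ltnS (ltn_predK lt_r).
Qed.

Definition has_transfers r x : Prop :=
  (exists2 c, c \in Rem x & r <= #|A_max x c|) \/
  (exists2 a, a \in Add x & r <= #|C_max x a|).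

Lemma leq_dim_loc_transfers x r : 0 < r -> r <= dim_loc x <-> has_transfers r x.
Proof.
move=> r_gt0; split=> [/(leq_dim_loc _ r_gt0)[S [clS Sx] lt_r] | x_r].
  have le_S (T : {set intpart n}) : S \subset T -> r <= #|T :\ x|.
    move=> sub_T; rewrite -ltnS (leq_trans lt_r) // -add1n.
    by have:= subset_leq_card sub_T; rewrite (cardsD1 x T) (subsetP sub_T x Sx).
  have [[c xc subS] | [a xa subS]] := clique_star_or_top clS Sx (leq_ltn_trans r_gt0 lt_r).
    left; exists c => //; case/setIdP: xc => xc _.
    by rewrite card_A_max //; apply: le_S.
  right; exists a => //; case/setIdP: xa; rewrite in_setC => xa _.
  by rewrite card_C_max //; apply: le_S.
apply/(leq_dim_loc _ r_gt0); case: x_r => [[c /setIdP[xc _]] | [a /setIdP[xa _]]].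
  rewrite card_A_max // => le_r; exists (star x c); last first.
    by rewrite (cardsD1 x) mem_star.
  by split; [apply: star_clique | apply: mem_star].
rewrite in_setC in xa; rewrite card_C_max // => le_r; exists (top x a); last first.
  by rewrite (cardsD1 x) mem_top.
by split; [apply: top_clique | apply: mem_top].
Qed.

(** The graph of partitions of 1 has a single vertex. This reconciles the value 0
    assigned by convention to the capacities for n = 1 with the counts of
    transfers. *)
Lemma has_transfers_neq1 x r : 0 < r -> has_transfers r x -> n != 1.
Proof.
move=> r_gt0 /(leq_dim_loc_transfers _ r_gt0)/(leq_dim_loc _ r_gt0)[S _ lt_r].
have /card_gt1P[y [z [_ _]]] := leq_ltn_trans r_gt0 lt_r.
apply: contra_neqN => /eqP n1; apply: val_inj => /=.
suff parts1 (w : intpart n) : parts w = [:: 1] by rewrite !parts1.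
have := sumn_intpart w; have := size_intpart w; move: (parts w).
by rewrite n1 => -[|p []] //= _; rewrite addn0 => ->.
Qed.

Lemma leq_capacity_transfers x r : 0 < r ->
  (r <= star_capacity x \/ r <= top_capacity x) <-> has_transfers r x.
Proof.
move=> r_gt0; rewrite /star_capacity /top_capacity; have [n1 | _] := eqVneq.
  split=> [|/(has_transfers_neq1 r_gt0)]; last by rewrite n1.
  by rewrite leqNgt r_gt0 => -[].
by split=> -[] /(leq_bigmax_exists _ _ r_gt0); [left|right|left|right].
Qed.

End Partitions.

(** * Staircases *)

Definition stair r : seq nat := mkseq (fun i => r - i) r.

Lemma nth_stair r i : nth 0 (stair r) i = r - i.
Proof.
have [lt_ir|le_ri] := ltnP i r; first by rewrite nth_mkseq.
by rewrite nth_default ?size_mkseq // (eqP le_ri).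
Qed.

Lemma stair_incr_partition r i : i <= r ->
  is_partition_of (sumn (stair r)).+1 (incr_nth (stair r) i).
Proof.
move=> le_ir; apply/and3P; split; last by rewrite sumn_incr_nth.
- apply/(sortedP 0) => k _; rewrite /= !nth_incr_nth !nth_stair.
  have [lt_kr | le_rk] := ltnP k r.
    by rewrite -(subnSK lt_kr) addnS -addSn leq_add2r; case: eqP.
  rewrite (ltn_eqF (leq_ltn_trans le_ir _)) //.
  by rewrite (leq_trans _ (leq_addl _ _)) // leq_sub2l.
apply/(nthP 0) => -[k]; rewrite size_incr_nth size_mkseq nth_incr_nth nth_stair.
move=> lt_k /eqP; rewrite addn_eq0 eqb0 subn_eq0 => /andP[ne_ik le_rk].
case/negP: ne_ik; rewrite eqn_leq (leq_trans le_ir le_rk) /=.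
by move: lt_k; case: (ltnP i r) => // _; rewrite ltnNge le_rk.
Qed.

Definition stair_partition r (i : 'I_r.+1) : intpart (sumn (stair r)).+1 :=
  IntPart (stair_incr_partition (ltn_ord i : i <= r)).

Lemma nth_stair_partition r (i : 'I_r.+1) k :
  nth 0 (stair_partition i) k = (i == k :> nat) + (r - k).
Proof. by rewrite /= nth_incr_nth nth_stair. Qed.

Lemma stair_partition_inj r : injective (@stair_partition r).
Proof.
move=> i j eq_ij; apply/val_inj/eqP; rewrite /= eq_sym.
have := nth_stair_partition i i; rewrite eq_ij nth_stair_partition => /eqP.
by rewrite eqxx eqn_add2r; case: (j == i :> nat).
Qed.

(** The staircase with r rows has r + 1 addable cells; filling one of them at a
    time yields r + 1 partitions that share all cells but one. *)
Lemma stair_dim_loc r : 0 < r -> r <= dim_loc (@stair_partition r ord0).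
Proof.
move=> r_gt0; set x := stair_partition _.
have lt_r : r < (sumn (stair r)).+2.
  by have := nth_intpart_leq x 0; rewrite nth_stair_partition subn0 => /leqW.
(* The cell that x has in addition to the staircase. *)
pose c : cell (sumn (stair r)).+1 := (ord0, Ordinal lt_r).
apply/(leq_dim_loc _ r_gt0); exists (star x c).
  by split; [apply: star_clique | apply: mem_star];
    rewrite mem_ferrers nth_stair_partition subn0.
rewrite -[r.+1]card_ord -cardsT -(card_imset _ (@stair_partition_inj r)).
apply/subset_leq_card/subsetP => _ /imsetP[i _ ->]; rewrite inE.
apply/subsetP => d; rewrite in_setD1 !mem_ferrers !nth_stair_partition.
case/andP=> ne_dc lt_d; apply: leq_trans (leq_addl _ _); move: lt_d.
case: (0 =P d.1 :> nat) => [d1_0 | //]; rewrite -d1_0 subn0 ltnS leq_eqVlt.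
case/predU1P=> // d2_r; case/eqP: ne_dc; case: d d1_0 d2_r => d1 d2 /= d1_0 d2_r.
by congr (_, _); apply: val_inj.
Qed.

Theorem proposition3p6 (r : nat) (hr : 2 <= r) :
  exists m : nat,
    [/\ is_tau_ge r m,
        is_min (fun n => 1 <= n /\ exists x : intpart n,
                  r <= star_capacity x \/ r <= top_capacity x) m
      & is_min (fun n => 1 <= n /\ exists x : intpart n,
                  (exists2 c : cell n, c \in Rem x & r <= #|A_max x c|) \/
                  (exists2 a : cell n, a \in Add x & r <= #|C_max x a|)) m].
Proof.
have r_gt0 : 0 < r := ltnW hr.
have ex_n : exists n, (0 < n) && (L_ge r n != set0).
  exists (sumn (stair r)).+1; apply/set0Pn; exists (@stair_partition r ord0).
  by rewrite inE stair_dim_loc.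
have transfersP n : L_ge r n != set0 <-> exists x : intpart n, has_transfers r x.
  split=> [/set0Pn[x] | [x x_r]].
    by rewrite inE => /(leq_dim_loc_transfers _ r_gt0) x_r; exists x.
  by apply/set0Pn; exists x; rewrite inE; apply/leq_dim_loc_transfers.
case: (ex_minnP ex_n) => m /andP[m_gt0 m_r] min_m; exists m; split.
- by split=> // k [k_gt0 k_r]; apply: min_m; rewrite k_gt0.
- split=> [|k [k_gt0 [x x_r]]].
    by split=> //; have /transfersP[x x_r] := m_r; exists x; apply/leq_capacity_transfers.
  apply: min_m; rewrite k_gt0; apply/transfersP; exists x.
  exact/leq_capacity_transfers.
split=> [|k [k_gt0 k_r]]; first by split=> //; apply/transfersP.
by apply: min_m; rewrite k_gt0; apply/transfersP.
Qed.
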